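(* Let $\epsilon$ be a valuation, let $\mathbf p,\mathbf p_1,\mathbf p_2$ be expectation lower bounds (functions from valuations to $[0,1]$), let $\mathbf 0$ be the expectation lower bound that is constantly $0$, let $s$ be a pGCL program, and let $\varphi,\varphi_1,\varphi_2$ be well-formed pDL formulae. Then: 1. (Universal lower bound) $\epsilon\models[s]_{\mathbf 0}\,\varphi$. 2. (Quantitative weakening) If $\epsilon\models[s]_{\mathbf p_1}\,\varphi$ and $\mathbf p_2\le\mathbf p_1$ everywhere, then $\epsilon\models[s]_{\mathbf p_2}\,\varphi$. 3. (Weakening conjunctions) If $\epsilon\models[s]_{\mathbf p}\,(\varphi_1\wedge\varphi_2)$, then $\epsilon\models[s]_{\mathbf p}\,\varphi_i$ for $i=1,2$. 4. (Qualitative weakening) If $\epsilon\models[s]_{\mathbf p}\,\varphi_1$ and $\models\varphi_1\rightarrow\varphi_2$, then $\epsilon\models[s]_{\mathbf p}\,\varphi_2$.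
   Context: **Programs (pGCL).** Fix a set $X$ of program variables. Expressions $e$ are built from program variables and primitive values (Booleans, numbers, ...) with the usual unary/binary arithmetic, comparison and logical operators; they are assumed well-formed, and $\epsilon(e)$ denotes the value of $e$ in a valuation $\epsilon$ (a map from program variables to values). Programs are $$s ::= s\sqcap s \mid s\,{}_{e}\!\oplus s\mid s;s\mid \mathtt{skip}\mid x:=e\mid \mathtt{if}\ e\ \{s\}\ \mathtt{else}\ \{s\}\mid\mathtt{while}\ e\ \{s\},$$ where $\sqcap$ is demonic (non-deterministic) choice and ${}_e\oplus$ is probabilistic choice (left branch with probability given by the value of $e$). **MDP semantics.** A program $s$ denotes a Markov decision process $\mathcal M_s$ with states $\langle\epsilon,s'\rangle$ (valuation, program). A positional policy $\pi$ maps states to available actions; the only states with more than one action are those where a demonic choice is to be resolved, and $\pi\langle\epsilon,s_1\sqcap s_2\rangle\in\{s_1,s_2\}$. For a policy $\pi$, the probabilistic transitions $\sigma\xrightarrow{p}_\pi\sigma'$ are given by the rules: - $\langle\epsilon,x:=e\rangle\xrightarrow{1}_\pi\langle\epsilon[x\mapsto\epsilon(e)],\mathtt{skip}\rangle$; - if $\epsilon(e)=p\in[0,1]$: $\langle\epsilon,s_1\,{}_e\!\oplus s_2\rangle\xrightarrow{p}_\pi\langle\epsilon,s_1\rangle$ and $\langle\epsilon,s_1\,{}_e\!\oplus s_2\rangle\xrightarrow{1-p}_\pi\langle\epsilon,s_2\rangle$ (probabilities are added if the targets coincide); - if $\pi\langle\epsilon,s_1\sqcap s_2\rangle=s_i$: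 $\langle\epsilon,s_1\sqcap s_2\rangle\xrightarrow{1}_\pi\langle\epsilon,s_i\rangle$; - if $\langle\epsilon,s_1\rangle\xrightarrow{p}_\pi\langle\epsilon',s_2\rangle$: $\langle\epsilon,\mathtt{skip};s_1\rangle\xrightarrow{p}_\pi\langle\epsilon',s_2\rangle$ and $\langle\epsilon,s_1;s\rangle\xrightarrow{p}_\pi\langle\epsilon',s_2;s\rangle$; - $\langle\epsilon,\mathtt{if}\ e\ \{s_1\}\ \mathtt{else}\ \{s_2\}\rangle\xrightarrow{1}_\pi\langle\epsilon,s_1\rangle$ if $\epsilon(e)=\mathit{true}$, and $\xrightarrow{1}_\pi\langle\epsilon,s_2\rangle$ if $\epsilon(e)=\mathit{false}$; - $\langle\epsilon,\mathtt{while}\ e\ \{s\}\rangle\xrightarrow{1}_\pi\langle\epsilon,s;\mathtt{while}\ e\ \{s\}\rangle$ if $\epsilon(e)=\mathit{true}$, and $\xrightarrow{1}_\pi\langle\epsilon,\mathtt{skip}\rangle$ if $\epsilon(e)=\mathit{false}$. A state is final if it has no transitions; the state $\langle\epsilon,\mathtt{skip}\rangle$ is final. Standing assumption: every program considered (every program occurring inside a box) reaches, from every initial valuation and under every policy, a state of the form $\langle\epsilon',\mathtt{skip}\rangle$ with probability $1$. **Expectations.** A path is a finite sequence of states $\sigma_1,\dots,\sigma_n$ with consecutive positive-probability transitions under $\pi$ ending in a final state $\mathrm{final}(\overline\sigma)=\sigma_n$; $\Pr(\overline\sigma)$ is the product of its transition probabilities (equal to $1$ for a one-state path), and $\mathrm{paths}_\pi(\sigma)$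 is the set of paths from $\sigma$. For a reward $r$ with values in $[0,1]$ on final states, $$\mathbb E_{\sigma,\pi}\,r=\sum_{\overline\sigma\in\mathrm{paths}_\pi(\sigma)}\Pr(\overline\sigma)\,r(\mathrm{final}(\overline\sigma)),\qquad \mathbf E_\sigma\,r=\inf_\pi\mathbb E_{\sigma,\pi}\,r .$$ A function of valuations is regarded as a reward by evaluating it on the valuation of the final state. For program $s$ and valuation $\epsilon$, the expectation ''from $\epsilon$ in $\mathcal M_s$'' means $\mathbf E_{\langle\epsilon,s\rangle}$. **Logic (pDL).** Let $L$ be a set of logical variables disjoint from $X$; each $l\in L$ has a domain $\mathrm{dom}\,l$ of values. Formulae are $$\varphi::=\text{atomic formula}\mid\neg\varphi\mid\varphi_1\wedge\varphi_2\mid\forall l\cdot\varphi\mid[s]_{\mathbf p}\,\varphi,$$ where atomic formulae are built from constants, program variables and logical variables, $s$ is a pGCL program (it mentions no logical variables), and $\mathbf p$ is an expectation lower bound, i.e. a function from valuations of program variables to $[0,1]$. $\to,\vee,\exists$ are derived as usual. A formula is well-formed if it has no free logical variables. Satisfaction $\epsilon\models\varphi$ is defined by: standard satisfaction for atomic formulae; the classical clauses for $\neg,\wedge$; $\epsilon\models\forall l\cdot\varphi$ iff $\epsilon\models\varphi[l:=v]$ for each $v\in\mathrm{dom}\,l$; and $$\epsilon\models[s]_{\mathbf p}\,\varphi\quad\text{iff}\quad \mathbf p(\epsilon)\le\mathbf E_{\langle\epsilon,s\rangle}[\![\varphi]\!]\ \text{ in }\mathcal M_s,$$ where $[\![\varphi]\!](\epsilon')=1$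 if $\epsilon'\models\varphi$ and $0$ otherwise. $\models\varphi$ means $\epsilon\models\varphi$ for all valuations $\epsilon$. *)

(* Defs.v *)
From HB Require Import structures.
From mathcomp Require Import all_boot all_order all_algebra.
From mathcomp Require Import boolp classical_sets functions reals ereal.
From mathcomp Require Import interval_inference esum.

Set Implicit Arguments.
Unset Strict Implicit.
Unset Printing Implicit Defensive.

Import Order.TTheory GRing.Theory Num.Theory.
Local Open Scope classical_set_scope.
Local Open Scope ring_scope.

(* Expressions are intrinsically sorted, so the ones that can be written are
   exactly the well-formed ones and evaluation is total (division by 0 follows
   the library convention x / 0 = 0).  Besides Booleans and (real) numbers, an
   arbitrary inhabited type of further primitive values is allowed. *)
Inductive sort := Bool | Num | Data.

Definition carrier (R : realType) (D : pointedType) (t : sort) : choiceType :=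
  match t with Bool => bool | Num => R | Data => D end.

Definition default (R : realType) (D : pointedType) (t : sort) :
    carrier R D t :=
  match t with Bool => false | Num => 0 | Data => point end.

Record signature (R : realType) := Signature {
  data : pointedType;
  pvar : choiceType;
  psort : pvar -> sort;
  lvar : choiceType;
  lsort : lvar -> sort;
  ldom : forall l : lvar, set (carrier R data (lsort l)) }.

Inductive unop : sort -> sort -> Type :=
| Opp : unop Num Num
| Not : unop Bool Bool.

Inductive binop : sort -> sort -> sort -> Type :=
| Add : binop Num Num Num
| Sub : binop Num Num Num
| Mul : binop Num Num Num
| Div : binop Num Num Num
| Le : binop Num Num Bool
| Lt : binop Num Num Bool
| Eq t : binop t t Bool
| And : binop Bool Bool Bool
| Or : binop Bool Bool Bool.

Section Language.
Context {R : realType} (S : signature R).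

Let val (t : sort) := carrier R (data S) t.

Definition eval_unop a b (o : unop a b) : val a -> val b :=
  match o in unop a b return val a -> val b with
  | Opp => fun x : R => - x
  | Not => negb
  end.

Definition eval_binop a b c (o : binop a b c) : val a -> val b -> val c :=
  match o in binop a b c return val a -> val b -> val c with
  | Add => fun x y : R => x + y
  | Sub => fun x y : R => x - y
  | Mul => fun x y : R => x * y
  | Div => fun x y : R => x / y
  | Le => fun x y : R => x <= y
  | Lt => fun x y : R => x < y
  | Eq t => fun x y : val t => x == y
  | And => andb
  | Or => orb
  end.

Inductive expr (V : Type) (vs : V -> sort) : sort -> Type :=
| Var (x : V) : expr vs (vs x)
| Const t (c : val t) : expr vs t
| Unop a b (o : unop a b) (e : expr vs a) : expr vs b
| Binop a b c (o : binop a b c) (e1 : expr vs a) (e2 : expr vs b) : expr vs c.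

Fixpoint eval V (vs : V -> sort) (eta : forall x, val (vs x)) t
    (e : expr vs t) : val t :=
  match e in expr _ t return val t with
  | Var x => eta x
  | Const _ c => c
  | Unop _ _ o e => eval_unop o (eval eta e)
  | Binop _ _ _ o e1 e2 => eval_binop o (eval eta e1) (eval eta e2)
  end.

Fixpoint subst_expr V (vs : V -> sort) (theta : forall x, expr vs (vs x)) t
    (e : expr vs t) : expr vs t :=
  match e in expr _ t return expr vs t with
  | Var x => theta x
  | Const _ c => Const vs c
  | Unop _ _ o e => Unop o (subst_expr theta e)
  | Binop _ _ _ o e1 e2 =>
      Binop o (subst_expr theta e1) (subst_expr theta e2)
  end.

Fixpoint occurs (V : eqType) (vs : V -> sort) (x : V) t (e : expr vs t) :
    bool :=
  match e with
  | Var y => x == y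
  | Const _ _ => false
  | Unop _ _ _ e => occurs x e
  | Binop _ _ _ _ e1 e2 => occurs x e1 || occurs x e2
  end.

Definition valuation : Type := forall x : pvar S, val (psort x).

Inductive prog :=
| Demon (s1 s2 : prog)
| PChoice (e : expr (@psort R S) Num) (s1 s2 : prog)
| Seq (s1 s2 : prog)
| Skip
| Assign (x : pvar S) (e : expr (@psort R S) (psort x))
| If (e : expr (@psort R S) Bool) (s1 s2 : prog)
| While (e : expr (@psort R S) Bool) (s : prog).

HB.instance Definition _ := gen_eqMixin valuation.
HB.instance Definition _ := gen_choiceMixin valuation.
HB.instance Definition _ := gen_eqMixin prog.
HB.instance Definition _ := gen_choiceMixin prog.

Definition state : choiceType := (valuation * prog)%type.

(* Only states resolving a demonic choice have several actions; the unique
   action of any other state carries no information and is named after the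
   program of the state. *)
Definition actions (sg : state) : set prog :=
  match sg.2 with
  | Demon s1 s2 => [set s1; s2]
  | s => [set s]
  end.

Record policy := Policy {
  act :> state -> prog;
  actP : forall sg, actions sg (act sg) }.

(* The transitions out of <eps, s>, as a list of (probability, target); the
   same target may be listed twice, see [tprob].  A probabilistic choice whose
   weight lies outside [0, 1] has no transition, nor has [skip; skip]. *)
Fixpoint step (pi : policy) (eps : valuation) (s : prog) : seq (R * state) :=
  match s with
  | Demon s1 s2 => [:: (1, (eps, pi (eps, Demon s1 s2)))]
  | PChoice e s1 s2 =>
      let p : R := eval eps e in
      if 0 <= p <= 1 then [:: (p, (eps, s1)); (1 - p, (eps, s2))] else [::]
  | Seq s1 s2 =>
      if s1 is Skip then step pi eps s2
      else [seq (t.1, (t.2.1, Seq t.2.2 s2) : state) | t <- step pi eps s1]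
  | Skip => [::]
  | Assign x e => [:: (1, (dfwith eps (eval eps e) : valuation, Skip))]
  | If e s1 s2 => [:: (1, (eps, if eval eps e : bool then s1 else s2))]
  | While e s1 =>
      [:: (1, (eps, if eval eps e : bool then Seq s1 (While e s1) else Skip))]
  end.

Definition tprob (pi : policy) (sg sg' : state) : R :=
  \sum_(t <- step pi sg.1 sg.2 | t.2 == sg') t.1.

Definition final (pi : policy) (sg : state) : bool := nilp (step pi sg.1 sg.2).

(* A path from [sg] is represented by the sequence of its states after [sg]. *)
Definition paths (pi : policy) (sg : state) : set (seq state) :=
  [set rho | path (fun a b => 0 < tprob pi a b) sg rho
             /\ final pi (last sg rho)].

Definition path_prob (pi : policy) (sg : state) (rho : seq state) : R :=
  \prod_(q <- pairmap (tprob pi) sg rho) q.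

(* [esum] is the sum of a family of nonnegative terms: rewards are meant to
   take values in [0, 1]. *)
Definition expect_pol (pi : policy) (sg : state) (r : state -> R) : \bar R :=
  (\esum_(rho in paths pi sg) (path_prob pi sg rho * r (last sg rho))%:E)%E.

Definition expect (sg : state) (r : state -> R) : \bar R :=
  ereal_inf [set expect_pol pi sg r | pi in [set: policy]].

Definition terminates_as (s : prog) : Prop :=
  forall (eps : valuation) (pi : policy),
    expect_pol pi (eps, s) (fun sg => `[< sg.2 = Skip >]%:R) = 1%E.

Definition lower_bound : Type := valuation -> {i01 R}.

Definition zero_bound : lower_bound := fun=> 0%:i01.

Definition var : eqType := (pvar S + lvar S)%type.

Definition vsort (x : var) : sort :=
  match x with inl x => psort x | inr l => lsort l end.

(* Atomic formulae are the Boolean-sorted expressions over program and logical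
   variables. *)
Inductive formula :=
| Atom (a : expr vsort Bool)
| Neg (f : formula)
| Conj (f1 f2 : formula)
| Forall (l : lvar S) (f : formula)
| Box (s : prog) (p : lower_bound) (f : formula).

Definition Imp (f1 f2 : formula) : formula := Neg (Conj f1 (Neg f2)).

Fixpoint free_in (l : lvar S) (f : formula) : bool :=
  match f with
  | Atom a => occurs (inr l : var) a
  | Neg f => free_in l f
  | Conj f1 f2 => free_in l f1 || free_in l f2
  | Forall k f => (l != k) && free_in l f
  | Box _ _ f => free_in l f
  end.

Definition well_formed (f : formula) : Prop := forall l, ~~ free_in l f.

(* Substitution of a value for a logical variable; values being closed, no
   capture can occur. *)
Fixpoint subst (l : lvar S) (v : val (lsort l)) (f : formula) : formula :=
  match f with
  | Atom a =>
      Atom (subst_expr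
        (dfwith (fun x : var => Var vsort x) (i := inr l) (Const vsort v)) a)
  | Neg f => Neg (subst v f)
  | Conj f1 f2 => Conj (subst v f1) (subst v f2)
  | Forall k f => Forall k (if k == l then f else subst v f)
  | Box s p f => Box s p (subst v f)
  end.

(* The values given to logical variables are never used when evaluating an
   atom in which no logical variable occurs. *)
Definition extend (eps : valuation) (x : var) : val (vsort x) :=
  match x with inl x => eps x | inr l => default R (data S) (lsort l) end.

Fixpoint depth (f : formula) : nat :=
  match f with
  | Atom _ => 1
  | Neg f => (depth f).+1
  | Conj f1 f2 => (maxn (depth f1) (depth f2)).+1
  | Forall _ f => (depth f).+1
  | Box _ _ f => (depth f).+1
  end.

(* The clause for quantifiers recurses on a substitution instance, hence the
   bound [n] on the depth, which is harmless: see the equations [sat_Atom],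
   [sat_Neg], [sat_Conj], [sat_Forall] and [sat_Box] below. *)
Fixpoint sat_upto (n : nat) (eps : valuation) (f : formula) : Prop :=
  if n is n'.+1 then
    match f with
    | Atom a => is_true (eval (extend eps) a : bool)
    | Neg f => ~ sat_upto n' eps f
    | Conj f1 f2 => sat_upto n' eps f1 /\ sat_upto n' eps f2
    | Forall l f => forall v, ldom v -> sat_upto n' eps (subst (l := l) v f)
    | Box s p f =>
        ((p eps)%:num%:E
         <= expect (eps, s) (fun sg => `[< sat_upto n' sg.1 f >]%:R))%E
    end
  else False.

Definition sat (eps : valuation) (f : formula) : Prop :=
  sat_upto (depth f) eps f.

Definition valid (f : formula) : Prop := forall eps, sat eps f.

(* Every program occurring in a box of the formula almost surely terminates. *)
Fixpoint boxes_terminate (f : formula) : Prop :=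
  match f with
  | Atom _ => True
  | Neg f => boxes_terminate f
  | Conj f1 f2 => boxes_terminate f1 /\ boxes_terminate f2
  | Forall _ f => boxes_terminate f
  | Box s _ f => terminates_as s /\ boxes_terminate f
  end.

Lemma depth_subst l (v : val (lsort l)) f : depth (subst v f) = depth f.
Proof.
elim: f => //= [f -> //|f1 -> f2 -> //|k f IH|s p f -> //].
by case: ifP => // _; rewrite IH.
Qed.

Lemma sat_uptoE n eps f : (depth f <= n)%N -> sat_upto n eps f = sat eps f.
Proof.
rewrite /sat; have [m] := ubnP (depth f).
elim: m => // m IH in n eps f *; case: n => [|n]; first by case: f.
have IHn g k eps' : (depth g < m)%N -> (depth g <= k)%N ->
  sat_upto k eps' g = sat_upto (depth g) eps' g by exact: IH.
case: f => [a|f|f1 f2|l f|s p f] //=; rewrite !ltnS => fm fn.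
- by rewrite (IHn _ n).
- move: fm fn; rewrite !geq_max !gtn_max => /andP[m1 m2] /andP[n1 n2].
  by rewrite !(IHn _ n)// !(IHn _ (maxn _ _))// ?leq_maxl ?leq_maxr.
- apply: eq_forall => v; congr (_ -> _).
  by rewrite (IHn _ n) ?depth_subst// (IHn _ (depth f)) ?depth_subst.
- congr (_ <= expect _ _)%E; apply/funext => sg.
  by rewrite (IHn _ n).
Qed.

Lemma sat_Atom eps a : sat eps (Atom a) = (eval (extend eps) a : bool).
Proof. by []. Qed.

Lemma sat_Neg eps f : sat eps (Neg f) = (~ sat eps f).
Proof. by []. Qed.

Lemma sat_Conj eps f1 f2 : sat eps (Conj f1 f2) = (sat eps f1 /\ sat eps f2).
Proof. by rewrite /sat/= !sat_uptoE ?leq_maxl ?leq_maxr. Qed.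

Lemma sat_Forall eps l f :
  sat eps (Forall l f) = (forall v, ldom v -> sat eps (subst (l := l) v f)).
Proof.
rewrite /sat/=; apply: eq_forall => v; congr (_ -> _).
by rewrite depth_subst.
Qed.

Lemma sat_Box eps s p f :
  sat eps (Box s p f) =
  ((p eps)%:num%:E <= expect (eps, s) (fun sg => `[< sat sg.1 f >]%:R))%E.
Proof. by []. Qed.

End Language.

Arguments zero_bound {R} S.

(* Main.v *)
Require Import Defs.
From mathcomp Require Import all_boot all_order all_algebra.
From mathcomp Require Import boolp classical_sets reals ereal.
From mathcomp Require Import interval_inference esum.

Set Implicit Arguments.
Unset Strict Implicit.
Unset Printing Implicit Defensive.

Import Order.TTheory GRing.Theory Num.Theory.
Local Open Scope ring_scope.

(** Everything rests on monotonicity of the expectation in the reward. For a fixed policy it is a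
    sum of rewards weighted by nonnegative path probabilities, and the infimum over policies
    preserves pointwise inequalities ([expect_le]). Applied to indicators, this makes a box monotone
    in its postcondition ([sat_Box_impl]), which yields both the conjunction and the qualitative
    weakening. The universal bound is nonnegativity of the expectation ([expect_ge0]), and the
    quantitative weakening is transitivity of the order. *)

Section Expectation.
Context {R : realType} {S : signature R}.
Implicit Types (pi : policy S) (sg : state S) (r : state S -> R).

(** Membership in [paths] already makes every transition factor positive, so [step] need not be
    inspected. *)
Lemma path_prob_ge0 pi sg rho : paths pi sg rho -> 0 <= path_prob pi sg rho.
Proof.
case=> + _; rewrite /path_prob; elim: rho sg => [|sg' rho IH] sg /=.
  by rewrite big_nil.
by case/andP=> /ltW q_ge0 /IH ?; rewrite big_cons mulr_ge0.
Qed.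

Lemma expect_pol_le pi sg r1 r2 : (forall sg', r1 sg' <= r2 sg') ->
  (expect_pol pi sg r1 <= expect_pol pi sg r2)%E.
Proof.
move=> r12; apply: le_esum => rho /path_prob_ge0 q_ge0.
by rewrite lee_fin ler_wpM2l.
Qed.

Lemma expect_le sg r1 r2 : (forall sg', r1 sg' <= r2 sg') ->
  (expect sg r1 <= expect sg r2)%E.
Proof.
move=> r12; apply: le_ereal_inf_tmp => _ [pi _ <-].
(* The infimum for [r1] lies below the value of [r1] under this same policy [pi]; no optimal policy
   is required. *)
apply: le_trans (expect_pol_le pi sg r12).
by apply: ereal_inf_lbound; exists pi.
Qed.

Lemma expect_ge0 sg r : (forall sg', 0 <= r sg') -> (0 <= expect sg r)%E.
Proof.
move=> r_ge0; apply: le_ereal_inf_tmp => _ [pi _ <-]; apply: esum_ge0 => rho.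
by move=> /path_prob_ge0 q_ge0; rewrite lee_fin mulr_ge0.
Qed.

Lemma sat_Box_impl eps s (p : lower_bound S) (f1 f2 : formula S) :
  (forall eps', sat eps' f1 -> sat eps' f2) ->
  sat eps (Box s p f1) -> sat eps (Box s p f2).
Proof.
move=> f12; rewrite !sat_Box => /le_trans; apply; apply: expect_le => sg.
(* Where [f1] holds both indicators are 1; elsewhere the left one is 0. *)
by case: asboolP => [/f12/asboolT -> |_]; rewrite ?lexx ?ler0n.
Qed.

End Expectation.

Theorem proposition3 (R : realType) (S : signature R)
    (eps : valuation S) (p p1 p2 : lower_bound S)
    (s : prog S) (phi phi1 phi2 : formula S)
    (s_as : terminates_as s)
    (phi_wf : well_formed phi) (phi1_wf : well_formed phi1)
    (phi2_wf : well_formed phi2)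
    (phi_as : boxes_terminate phi) (phi1_as : boxes_terminate phi1)
    (phi2_as : boxes_terminate phi2) :
  [/\ sat eps (Box s (zero_bound S) phi),
      (sat eps (Box s p1 phi) ->
       (forall eps' : valuation S, (p2 eps')%:num <= (p1 eps')%:num) ->
       sat eps (Box s p2 phi)),
      (sat eps (Box s p (Conj phi1 phi2)) ->
       sat eps (Box s p phi1) /\ sat eps (Box s p phi2))
    & (sat eps (Box s p phi1) -> valid (Imp phi1 phi2) ->
       sat eps (Box s p phi2))].
Proof.
split.
- by rewrite sat_Box; apply: expect_ge0 => sg; rewrite ler0n.
- by rewrite !sat_Box => + p21; apply: le_trans; rewrite lee_fin.
- by move=> sat12; split; apply: sat_Box_impl sat12 => eps';
    rewrite sat_Conj => -[].
- move=> sat1 imp12; apply: sat_Box_impl sat1 => eps' sat1.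
  (* [Imp] unfolds to a negated conjunction, so [phi2] is recovered by classical contradiction. *)
  apply: contrapT => nsat2; have := imp12 eps'.
  by rewrite sat_Neg sat_Conj sat_Neg; apply.
Qed.
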